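(* Let $b\ge3$ be odd, $n$ an even positive integer, and $K$ the transition matrix of the balanced carries chain on $\{-\tfrac n2,\dots,\tfrac n2\}$ (defined in the context). For $0\le j\le n$ and $-\tfrac n2\le i\le\tfrac n2$ define \[ v_j^n[i]=\sum_{r=0}^{i+n/2}(-1)^r\binom{n+1}{r}(n+2i-2r+1)^{n-j}. \] Then for each $0\le j\le n$, $v_j^n$ is a left eigenvector of $K$ with eigenvalue $1/b^j$, i.e. $\sum_{i=-n/2}^{n/2} v_j^n[i]\,K(i,k)=b^{-j}v_j^n[k]$ for all $-\tfrac n2\le k\le \tfrac n2$.
   Context: Balanced digits base $b$ ($b$ odd) are the integers $-\tfrac{b-1}{2},\dots,\tfrac{b-1}{2}$. When $n$ numbers in balanced digits are added column by column from right to left, if the carry into a column is $i$ and the column digits are $X_1,\dots,X_n$, the carry out is the unique integer $j$ with $jb-\tfrac{b-1}{2}\le i+X_1+\cdots+X_n\le jb+\tfrac{b-1}{2}$; the first carry is $0$. With all digits independent and uniform on the balanced digit set, the carries form a Markov chain (the balanced carries chain), with state space $\{-\tfrac n2,\dots,\tfrac n2\}$ for $n$ even; $K(i,j)$ is the probability the carry out is $j$ given carry in $i$. *)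

(* Defs.v *)
From HB Require Import structures.
From mathcomp Require Import all_boot all_order all_algebra.

Set Implicit Arguments.
Unset Strict Implicit.
Unset Printing Implicit Defensive.

Import Order.TTheory GRing.Theory Num.Theory.
Local Open Scope ring_scope.

(* 'I_b enumerates the balanced digits -(b-1)/2, ..., (b-1)/2 in increasing
   order. *)
Definition balanced_digit (b : nat) (d : 'I_b) : int :=
  (d : nat)%:Z - (b.-1)./2%:Z.

(* A column whose total (carry in included) is s has carry out c; for b odd
   exactly one c satisfies this. *)
Definition is_carry_out (b : nat) (s c : int) : bool :=
  c * b%:Z - (b.-1)./2%:Z <= s <= c * b%:Z + (b.-1)./2%:Z.

(* The column digits X_1, ..., X_n are independent and uniform, so each column
   X has probability \prod_k b^-1. *)
Definition carry_prob (R : realFieldType) (b n : nat) (i c : int) : R :=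
  \sum_(X : {ffun 'I_n -> 'I_b}
        | is_carry_out b (i + \sum_(k < n) balanced_digit (X k)) c)
     \prod_(k < n) (b%:R)^-1.

(* For n even, 'I_n.+1 enumerates the states -n/2, ..., n/2 in increasing
   order. *)
Definition carry_state (n : nat) (s : 'I_n.+1) : int :=
  (s : nat)%:Z - n./2%:Z.

Definition balanced_carries_mx (R : realFieldType) (b n : nat) : 'M[R]_n.+1 :=
  \matrix_(s, t) carry_prob R b n (carry_state s) (carry_state t).

(* Only used for -n/2 <= i, where the absolute value `|i + n/2| is just
   i + n/2 as a natural number. *)
Definition left_entry (n j : nat) (i : int) : int :=
  \sum_(0 <= r < `|(i + n./2%:Z)%R|%N.+1)
     (-1) ^+ r * 'C(n.+1, r)%:Z * (n%:Z + 2 * i - 2 * r%:Z + 1) ^+ (n - j).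

Definition left_vec (R : realFieldType) (n j : nat) : 'rV[R]_n.+1 :=
  \row_s (left_entry n j (carry_state s))%:~R.

(* Main.v *)
(** Index the states by s = i + n/2, and put h = (b-1)/2, u = tb + h and
    Q = 1 + X + ... + X^(b-1).  A column goes from s to t exactly when
    s + d_1 + ... + d_n <= u < s + d_1 + ... + d_n + b for the shifted digits
    d_k in [0, b), so b^n K(s, t) is the coefficient of X^u in X^s Q^(n+1).
    On the other hand, v_j is the coefficient sequence of (1 - X)^(n+1) A with
    A = \sum_m (2m+1)^(n-j) X^m, a polynomial of degree at most n because
    (n+1)-st differences of polynomials of degree at most n vanish.  Hence
    b^n (v_j K)(t) is the coefficient of X^u in
    (1 - X)^(n+1) A Q^(n+1) = (1 - X^b)^(n+1) A, and 2(u - rb) + 1 is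
    b (2(t - r) + 1).  Power series are replaced by truncations of A. *)
Require Import Defs.
From HB Require Import structures.
From mathcomp Require Import all_boot all_order all_algebra.
From mathcomp Require Import zify ring.

Set Implicit Arguments.
Unset Strict Implicit.
Unset Printing Implicit Defensive.

Import Order.TTheory GRing.Theory Num.Theory.
Local Open Scope ring_scope.

(** Induction on [k], starting from [(1 - 1) ^+ m = 0]. One factor [x - c * r] is split off: the [x]
    part keeps [m], while in the other part [r] is absorbed into the binomial, which lowers [m] by
    one and shifts [x] by [c]. *)
Lemma alternating_binomial_powers (A : comNzRingType) (c : A) (k m : nat) (x : A) :
  (k < m)%N ->
  \sum_(r < m.+1) (-1) ^+ r * 'C(m, r)%:R * (x - c * r%:R) ^+ k = 0.
Proof.
elim: k m x => [|k IHk] m x lt_km.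
  have := exprBn (1 : A) 1 m; rewrite subrr expr0n gtn_eqF // => sum0.
  rewrite [RHS]sum0; apply: eq_bigr => r _.
  by rewrite expr0 !expr1n !mulr1 mulr_natr.
case: m => // m in lt_km *.
transitivity (x * (\sum_(r < m.+2) (-1) ^+ r * 'C(m.+1, r)%:R * (x - c * r%:R) ^+ k)
  + c * m.+1%:R * (\sum_(r < m.+1) (-1) ^+ r * 'C(m, r)%:R * ((x - c) - c * r%:R) ^+ k)).
  rewrite big_distrr [in LHS]big_ord_recl [in RHS]big_ord_recl /=.
  rewrite -addrA big_distrr -big_split /=; congr (_ + _).
    by rewrite exprS; ring.
  apply: eq_bigr => r _; rewrite /bump /= add1n.
  have absorb : (r.+1)%:R * 'C(m.+1, r.+1)%:R = m.+1%:R * 'C(m, r)%:R :> A.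
    by rewrite -!natrM mul_bin_diag.
  have -> : (x - c) - c * r%:R = x - c * r.+1%:R by rewrite -natr1; ring.
  rewrite -[c * m.+1%:R * _]mulrA [m.+1%:R * _]mulrA mulrCA.
  rewrite [m.+1%:R * _]mulrCA -absorb [(-1) ^+ r.+1]exprS [_ ^+ k.+1]exprS; ring.
by rewrite !IHk ?mulr0 ?addr0 // ltnW.
Qed.

Lemma coef_exp_sub1Xn_mul (A : comNzRingType) (c m w : nat) (p : {poly A}) :
  ((1 - 'X^c) ^+ m * p)`_w =
  \sum_(r < m.+1 | (c * r <= w)%N) (-1) ^+ r * 'C(m, r)%:R * p`_(w - c * r).
Proof.
rewrite exprBn big_distrl coef_sum [RHS]big_mkcond; apply: eq_bigr => r _ /=.
have -> : (-1) ^+ r = ((-1) ^+ r)%:P :> {poly A} by rewrite rmorphXn rmorphN1.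
rewrite expr1n mulr1 -exprM mulrnAl -!mulrA coefMn coefCM coefXnM ltnNge.
by case: leqP => _ /=; rewrite ?mulr0 ?mul0rn // -mulrnAr mulr_natl.
Qed.

Lemma eq_coefM (A : nzRingType) (p q r : {poly A}) (w : nat) :
  (forall i, (i <= w)%N -> p`_i = q`_i) -> (p * r)`_w = (q * r)`_w.
Proof.
move=> eq_pq; rewrite !coefM; apply: eq_bigr => i _.
by rewrite eq_pq // -ltnS.
Qed.

Lemma digit_poly_exp (A : comNzRingType) (b m : nat) :
  (\sum_(d < b) 'X^d) ^+ m
  = \sum_(X : {ffun 'I_m -> 'I_b}) 'X^(\sum_(k < m) X k) :> {poly A}.
Proof.
rewrite -[m in LHS]card_ord -prodr_const bigA_distr_bigA /=.
by apply: eq_bigr => X _; rewrite -expr_sum.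
Qed.

Lemma coef_Xn_digit_poly (A : nzRingType) (b m u : nat) :
  ('X^m * \sum_(d < b) 'X^d : {poly A})`_u = (m <= u < m + b)%:R.
Proof.
rewrite coefXnM; case: ltnP => //= le_mu.
have -> : \sum_(d < b) 'X^d = \poly_(i < b) 1 :> {poly A}.
  by rewrite poly_def; apply: eq_bigr => i _; rewrite scale1r.
by rewrite coef_poly ltn_subLR //; case: ifP.
Qed.

(** With [b = 2h + 1] and [n = 2g], the centring shift of the total is [g + n * h = g * b], exactly
    the shift in the carry bounds, so it cancels. *)
Lemma is_carry_out_shifted (b n s t S : nat) :
  odd b -> ~~ odd n ->
  is_carry_out b (s%:Z - n./2%:Z + (S%:Z - n%:Z * (b.-1)./2%:Z))
    (t%:Z - n./2%:Z)
  = (s + S <= t * b + (b.-1)./2 < s + S + b)%N.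
Proof.
move=> b_odd n_even; rewrite /is_carry_out.
set h := (b.-1)./2; set g := n./2.
have -> : b = h.*2.+1 by rewrite /h; lia.
have -> : n = g.*2 by rewrite /g; lia.
nia.
Qed.

Lemma carry_probE (R : realFieldType) (b n s t : nat) : odd b -> ~~ odd n ->
  carry_prob R b n (s%:Z - n./2%:Z) (t%:Z - n./2%:Z)
  = b%:R ^- n *
    (('X^s * (\sum_(d < b) 'X^d) ^+ n.+1 : {poly int})`_(t * b + (b.-1)./2))%:~R.
Proof.
move=> b_odd n_even.
(* Of the [n.+1] factors, [n] generate the digits; the remaining one turns the coefficient into the
   indicator of the window of [b] totals. *)
rewrite exprS mulrCA digit_poly_exp !mulr_sumr coef_sum rmorph_sum mulr_sumr.
rewrite /carry_prob big_mkcond; apply: eq_bigr => X _ /=.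
rewrite -exprD [_ * 'X^_]mulrC coef_Xn_digit_poly prodr_const card_ord exprVn.
have -> : \sum_(k < n) balanced_digit (X k)
    = (\sum_(k < n) X k)%N%:Z - n%:Z * (b.-1)./2%:Z.
  rewrite sumrB sumr_const card_ord -mulr_natl natz; congr (_ - _).
  by rewrite -natz natr_sum; apply: eq_bigr => k _; rewrite natz.
by rewrite is_carry_out_shifted //; case: ifP => _; rewrite ?mulr1 ?mulr0.
Qed.

Lemma left_entryE (n j s : nat) : ~~ odd n ->
  left_entry n j (s%:Z - n./2%:Z)
  = \sum_(r < s.+1) (-1) ^+ r * 'C(n.+1, r)%:R * (2 * (s - r)%N%:Z + 1) ^+ (n - j).
Proof.
move=> n_even; rewrite /left_entry subrK absz_nat big_mkord.
apply: eq_bigr => r _; rewrite ['C(_, _)%:R]natz; congr (_ * _ ^+ _).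
have := ltn_ord r; lia.
Qed.

Definition odd_power_poly (e N : nat) : {poly int} :=
  \poly_(m < N) (2 * m%:Z + 1) ^+ e.

(** Reconciles the range [r <= m] of the binomial theorem with the range [r <= t] of [left_entry]:
    the binomial vanishes for [r > m]. *)
Lemma sum_binomial_restrict (A : comNzRingType) (m t : nat) (F : nat -> A) :
  \sum_(r < m.+1 | (r <= t)%N) (-1) ^+ r * 'C(m, r)%:R * F r
  = \sum_(r < t.+1) (-1) ^+ r * 'C(m, r)%:R * F r.
Proof.
set G := fun r => (-1) ^+ r * 'C(m, r)%:R * F r.
rewrite (big_ord_widen_cond (m + t).+1 (fun r => r <= t)%N G); last by lia.
rewrite (big_ord_widen (m + t).+1 G); last by lia.
rewrite big_mkcond [RHS]big_mkcond; apply: eq_bigr => r _ /=.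
rewrite !ltnS /G; case: (leqP r m) => [_|lt_mr]; first by rewrite andbT.
by rewrite andbF bin_small // mulr0 mul0r; case: ifP.
Qed.

Lemma left_entry_coef (n j N s : nat) : ~~ odd n -> (s < N)%N ->
  ((1 - 'X) ^+ n.+1 * odd_power_poly (n - j) N)`_s
  = left_entry n j (s%:Z - n./2%:Z).
Proof.
move=> n_even lt_sN; rewrite left_entryE // -['X]expr1 coef_exp_sub1Xn_mul.
under eq_bigl do rewrite mul1n.
rewrite (sum_binomial_restrict _ _ (fun r => _`_(s - 1 * r))).
apply: eq_bigr => r _; rewrite coef_poly mul1n ifT //.
by rewrite (leq_ltn_trans (leq_subr _ _)).
Qed.

(** Past the last state the sum is a complete difference of order [n.+1], with step 2, of a power of
    degree at most [n]. *)
Lemma left_entry_out (n j s : nat) : ~~ odd n -> (n < s)%N ->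
  left_entry n j (s%:Z - n./2%:Z) = 0.
Proof.
move=> n_even lt_ns; rewrite left_entryE //.
have lt_e : (n - j < n.+1)%N by rewrite ltnS leq_subr.
rewrite -[RHS](alternating_binomial_powers 2 (2 * s%:Z + 1) lt_e).
rewrite -(sum_binomial_restrict _ _ (fun r => (2 * (s - r)%N%:Z + 1) ^+ (n - j))).
rewrite big_mkcond; apply: eq_bigr => r _; have := ltn_ord r => lt_r.
(* Here [r <= n.+1 <= s], so the subtraction [s - r] in [nat] is exact. *)
rewrite ifT; last by lia.
congr (_ * _ ^+ _); rewrite [r%:R]natz; lia.
Qed.

Lemma left_entry_eigen (b n j t : nat) : odd b -> ~~ odd n ->
  \sum_(s < n.+1) left_entry n j (s%:Z - n./2%:Z) *
    ('X^s * (\sum_(d < b) 'X^d) ^+ n.+1 : {poly int})`_(t * b + (b.-1)./2)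
  = b%:R ^+ (n - j) * left_entry n j (t%:Z - n./2%:Z).
Proof.
move=> b_odd n_even; set u := (t * b + _)%N; set Q := \sum_(d < b) _.
transitivity ((\poly_(s < n.+1) left_entry n j (s%:Z - n./2%:Z) * Q ^+ n.+1)`_u).
  rewrite poly_def big_distrl coef_sum; apply: eq_bigr => s _ /=.
  by rewrite -scalerAl coefZ.
(* Only the coefficient of degree [u] is read, so agreement up to degree [u] suffices and the series
   may be cut at [u.+1]. *)
rewrite (@eq_coefM _ _ ((1 - 'X) ^+ n.+1 * odd_power_poly (n - j) u.+1)); last first.
  move=> s le_su; rewrite coef_poly left_entry_coef //.
  by case: ltnP => // lt_ns; rewrite left_entry_out.
have -> : (1 - 'X) ^+ n.+1 * odd_power_poly (n - j) u.+1 * Q ^+ n.+1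
    = (1 - 'X^b) ^+ n.+1 * odd_power_poly (n - j) u.+1.
  rewrite mulrAC -exprMn; congr (_ ^+ _ * _).
  rewrite -{2}(expr1n {poly int} b) subrXX; congr (_ * _).
  by apply: eq_bigr => d _; rewrite expr1n mul1r.
rewrite coef_exp_sub1Xn_mul.
(* The remainder [(b.-1)./2] of [u] is less than [b]. *)
have le_bu r : (b * r <= u)%N = (r <= t)%N by rewrite /u; apply/idP/idP; nia.
under eq_bigl do rewrite le_bu.
rewrite (sum_binomial_restrict _ _ (fun r => _`_(u - b * r))).
rewrite left_entryE // big_distrr; apply: eq_bigr => r _ /=.
rewrite coef_poly ifT ?ltnS ?leq_subr // mulrCA -exprMn.
congr (_ * _ ^+ _); have := ltn_ord r; rewrite [b%:R]natz ltnS => le_rt.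
have -> : (u - b * r = (t - r) * b + (b.-1)./2)%N.
  by rewrite /u mulnBl [(b * r)%N]mulnC addnBAC // leq_mul2r le_rt orbT.
move: (t - r)%N => q; lia.
Qed.

Theorem theorem3p1 (R : realFieldType) (b n : nat)
  (hb : (3 <= b)%N) (b_odd : odd b) (hn : (0 < n)%N) (n_even : ~~ odd n)
  (j : nat) (hj : (j <= n)%N) :
  left_vec R n j != 0 /\
  left_vec R n j *m balanced_carries_mx R b n = (b%:R ^- j) *: left_vec R n j.
Proof.
split.
  (* The entry at the lowest state is [1 ^+ (n - j) = 1], so the vector is nonzero. *)
  apply/eqP => /rowP /(_ ord0); rewrite !mxE /carry_state left_entryE //.
  rewrite big_ord1 bin0 /= subn0 mulr0 add0r expr1n !mulr1 => /eqP.
  by rewrite oner_eq0.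
apply/rowP => t; rewrite !mxE.
under eq_bigr do rewrite !mxE /carry_state carry_probE // mulrCA -intrM.
rewrite -big_distrr -rmorph_sum /= left_entry_eigen // rmorphM rmorphXn /= rmorph_nat.
have b_neq0 : b%:R != 0 :> R by rewrite pnatr_eq0; lia.
(* Writing [n] as [(n - j) + j] cancels [b ^ (n - j)] and leaves the eigenvalue. *)
rewrite mulrA -{1}(subnK hj) exprD invfM; congr (_ * _).
by rewrite mulrAC mulVf ?mul1r // expf_neq0.
Qed.
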